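(* Let $n\ge 8$ and let $\Gamma(G)$ be a signed graph whose underlying graph $G$ belongs to $B_n^{++}$. Then $\eta(\Gamma(G))\le n-6$.
   Context: A signed graph $\Gamma(G)=(G,\sigma)$ consists of a simple graph $G$ and a map $\sigma:E(G)\to\{+,-\}$; its adjacency matrix has entry $\sigma(v_iv_j)$ for edges and $0$ otherwise, and $\eta(\Gamma(G))$ is the multiplicity of $0$ as an eigenvalue. A bicyclic graph is a connected simple graph with $|E|=|V|+1$. The graph $\infty(p,q,1)$ ($p,q\ge3$) is obtained from vertex-disjoint cycles $C_p$, $C_q$ by identifying a vertex of $C_p$ with a vertex of $C_q$. $B_n^{++}$ is the set of bicyclic graphs on $n$ vertices obtained from some $\infty(p,q,1)$ by (possibly) attaching trees to some of its vertices. *)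

(* Defs.v *)
From HB Require Import structures.
From mathcomp Require Import all_boot all_order all_algebra.

Set Implicit Arguments.
Unset Strict Implicit.
Unset Printing Implicit Defensive.

Import Order.TTheory GRing.Theory Num.Theory.
Local Open Scope ring_scope.

Record sgraph := SGraph {
  vertex :> finType;
  adj : rel vertex;
  adj_sym : symmetric adj;
  adj_irr : irreflexive adj
}.

Definition edges (G : sgraph) : {set {set G}} :=
  [set E : {set G} | [exists x, exists y, adj x y && (E == [set x; y])]].

Definition connected_graph (G : sgraph) : Prop :=
  forall x y : G, connect (@adj G) x y.

Definition acyclic_graph (G : sgraph) : Prop :=
  forall c : seq G, ucycle (@adj G) c -> (size c < 3)%N.

Definition is_tree (G : sgraph) : Prop :=
  connected_graph G /\ acyclic_graph G.

Definition bicyclic (G : sgraph) : Prop :=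
  connected_graph G /\ #|edges G| = (#|G| + 1)%N.

Section Induced.
Variables (G : sgraph) (P : pred G).

Definition induced_adj : rel {x : G | P x} :=
  fun x y => adj (val x) (val y).

Fact induced_adj_sym : symmetric induced_adj.
Proof. by move=> x y; apply: adj_sym. Qed.

Fact induced_adj_irr : irreflexive induced_adj.
Proof. by move=> x; apply: adj_irr. Qed.

Definition induced : sgraph := SGraph induced_adj_sym induced_adj_irr.
End Induced.

Section CycleGraph.
Variable p : nat.

(* For p >= 3 the conjunct i != j is redundant; it makes the definition total
   in p. *)
Definition cycle_adj : rel 'I_p :=
  fun i j => (i != j) && ((j == ordS i) || (i == ordS j)).

Fact cycle_adj_sym : symmetric cycle_adj.
Proof. by move=> i j; rewrite /cycle_adj eq_sym orbC. Qed.

Fact cycle_adj_irr : irreflexive cycle_adj.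
Proof. by move=> i; rewrite /cycle_adj eqxx. Qed.

Definition cycle_graph : sgraph := SGraph cycle_adj_sym cycle_adj_irr.
End CycleGraph.

(* The disjoint union of G and H with u and v identified: the merged vertex is
   represented by inl u, and v is removed from the copy of H. *)
Section Coalescence.
Variables (G H : sgraph) (u : G) (v : H).

Definition coalescence_adj : rel (G + {y : H | y != v})%type :=
  fun a b => match a, b with
  | inl x, inl x' => adj x x'
  | inr y, inr y' => adj (val y) (val y')
  | inl x, inr y | inr y, inl x => (x == u) && adj v (val y)
  end.

Fact coalescence_adj_sym : symmetric coalescence_adj.
Proof. by move=> [x|y] [x'|y'] //=; apply: adj_sym. Qed.

Fact coalescence_adj_irr : irreflexive coalescence_adj.
Proof. by move=> [x|y] /=; apply: adj_irr. Qed.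

Definition coalescence : sgraph :=
  SGraph coalescence_adj_sym coalescence_adj_irr.
End Coalescence.

(* G is obtained from H by attaching trees: f embeds H in G as an induced
   subgraph, and r sends each vertex of G to the vertex of H at which the tree
   containing it is attached. The fibre of r over b is the tree made of f b and
   everything attached at b (just f b if nothing is), and every edge of G lies
   either in one of these trees or in the copy of H. *)
Definition attaches_trees (H G : sgraph) : Prop :=
  exists (f : H -> G) (r : G -> H),
    [/\ cancel f r,
        (forall a b : H, adj (f a) (f b) = adj a b),
        (forall x y : G, adj x y ->
           r x = r y \/ (x = f (r x) /\ y = f (r y)))
      & (forall b : H, is_tree (induced [pred x : G | r x == b]))].

(* For u, v vertices of C_p, C_q, the graph coalescence u v is infinity(p,q,1).
*)
Definition Bpp (n : nat) (G : sgraph) : Prop :=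
  [/\ #|G| = n, bicyclic G
    & exists (p q : nat) (u : cycle_graph p) (v : cycle_graph q),
        [/\ (3 <= p)%N, (3 <= q)%N & attaches_trees (coalescence u v) G]].

(* sign takes an edge as an unordered pair {x, y}, true standing for the sign
   minus; its values on sets that are not edges are never used. *)
Record signed_graph := SignedGraph {
  underlying : sgraph;
  sign : {set underlying} -> bool
}.

Definition signed_adj_mx (R : rcfType) (S : signed_graph) :
    'M[R]_#|underlying S| :=
  \matrix_(i, j)
    let x := enum_val i in let y := enum_val j in
    if adj x y then (-1) ^+ sign [set x; y] else 0.

Definition nullity (R : rcfType) (S : signed_graph) : nat :=
  mup 0 (char_poly (signed_adj_mx R S)).

(* Main.v *)
(* The adjacency matrix A is symmetric over a real field, so the multiplicity of
   the eigenvalue 0 is n - rank A, and it suffices to show rank A >= 6. Whatever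
   the signs, this holds as soon as G contains three disjoint edges inducing a
   subgraph in which they can be exhausted by repeatedly deleting a leaf with
   its neighbour. If one of the two cycles has length at least 5, a path on four
   of its vertices and an edge of the other cycle, both avoiding the common
   vertex, do. Otherwise the two cycles have at most 7 vertices together, so
   n >= 8 provides a vertex pendant at some vertex of the cycles, with which to
   start the deletions. *)
Require Import Defs.
From mathcomp Require Import all_boot all_order all_algebra.
From mathcomp Require Import zify.

Set Implicit Arguments.
Unset Strict Implicit.
Unset Printing Implicit Defensive.

Import Order.TTheory GRing.Theory Num.Theory.
Local Open Scope ring_scope.

(** * Matrix rank and the multiplicity of the eigenvalue 0 *)

Lemma mxrank_mxsub (F : fieldType) (m n k l : nat) (f : 'I_k -> 'I_m)
    (g : 'I_l -> 'I_n) (A : 'M[F]_(m, n)) :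
  (\rank (mxsub f g A) <= \rank A)%N.
Proof.
have -> : mxsub f g A = rowsub f 1%:M *m A *m colsub g 1%:M.
  by rewrite mulmx_colsub mulmx1 mul_rowsub_mx mul1mx -mxsub_comp.
exact: leq_trans (mxrankM_maxl _ _) (mxrankM_maxr _ _).
Qed.

(** Rows [f] and columns [g] cut out a lower triangular submatrix with nonzero diagonal, which is
    invertible. *)
Lemma leq_mxrank_trig (F : fieldType) (m n k : nat) (f : 'I_k -> 'I_m)
    (g : 'I_k -> 'I_n) (A : 'M[F]_(m, n)) :
    (forall i, A (f i) (g i) != 0) ->
    (forall i j : 'I_k, (i < j)%N -> A (f i) (g j) = 0) ->
  (k <= \rank A)%N.
Proof.
move=> diag_neq0 upper0; apply: leq_trans (mxrank_mxsub f g A).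
rewrite mxrank_unit // unitmxE det_trig.
  by rewrite unitfE; apply/prodf_neq0 => i _; rewrite mxE.
by apply/is_trig_mxP => i j lt_ij; rewrite mxE upper0.
Qed.

(* Both sides are the determinant of [[X, C], [D, 1]] times X^r, computed by
   clearing the lower left block with column, resp. row, operations. *)
Lemma char_poly_mulmxC (R : comNzRingType) (n r : nat) (C : 'M[R]_(n, r))
    (D : 'M[R]_(r, n)) :
  'X^r * char_poly (C *m D) = 'X^n * char_poly (D *m C).
Proof.
pose C' := map_mx polyC C; pose D' := map_mx polyC D.
pose M := block_mx ('X%:M) C' D' 1%:M.
have detM : \det M = char_poly (C *m D).
  rewrite -[LHS]mulr1 -(_ : \det (block_mx 1%:M 0 (- D') 1%:M) = 1); last first.
    by rewrite det_lblock !det1 mul1r.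
  rewrite -det_mulmx mulmx_block !mulmx1 !mul1mx !mulmx0 addrN !add0r.
  by rewrite det_ublock det1 mulr1 mulmxN -map_mxM.
have detL : \det (block_mx 1%:M 0 (- D') 'X%:M) = 'X^r.
  by rewrite det_lblock det1 mul1r det_scalar.
rewrite -detM -detL -det_mulmx mulmx_block !mul1mx !mul0mx !addr0 mulmx1 mulNmx
  scalar_mxC addNr det_ublock det_scalar mulNmx; congr (_ * _).
by rewrite /char_poly /char_poly_mx map_mxM addrC.
Qed.

Lemma mulmx_trmx_eq0 (R : realDomainType) (n : nat) (w : 'rV[R]_n) :
  w *m w^T = 0 -> w = 0.
Proof.
move=> /matrixP/(_ 0 0); rewrite !mxE => /psumr_eq0P w0.
apply/rowP => j; rewrite mxE; apply/eqP.
have /eqP := w0 (fun i _ => ltac:(rewrite mxE; exact: sqr_ge0)) j isT.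
by rewrite mxE mulf_eq0 orbb.
Qed.

(* Write A = C D with C and D of full rank: A and D C have the same nonzero
   eigenvalues, and symmetry makes D C nonsingular. *)
Lemma mup0_char_poly_sym (R : realFieldType) (n : nat) (A : 'M[R]_n) :
  A^T = A -> mup 0 (char_poly A) = (n - \rank A)%N.
Proof.
move=> symA; set C := col_base A; set D := row_base A.
have DC_free : row_free (D *m C).
  apply: inj_row_free => u uDC0.
  have uDA0 : u *m D *m A = 0.
    have <- : u *m (D *m C) *m D = u *m D *m A.
      by rewrite mulmxA -(mulmxA (u *m D)) [C *m D]mulmx_base.
    by rewrite uDC0 mul0mx.
  (* Symmetry enters here: if u D = z A, then (u D)(u D)^T = u D A z^T = 0, and a vanishing sum of
     squares forces u D = 0. *)
  have /submxP[z uDE] : (u *m D <= A)%MS.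
    by rewrite (submx_trans (submxMl _ _)) // eq_row_base.
  apply/eqP; rewrite -(mulmx_free_eq0 _ (row_base_free A)); apply/eqP.
  apply: mulmx_trmx_eq0.
  by rewrite [X in _ *m X^T]uDE trmx_mul symA mulmxA uDA0 mul0mx.
have root0 : ~~ root (char_poly (D *m C)) 0.
  rewrite rootE horner_coef0 char_poly_det mulf_neq0 ?signr_eq0 //.
  by rewrite -unitfE -unitmxE -row_free_unit.
have mupXn m : mup 0 ('X^m : {poly R}) = m.
  by have := mup_XsubCX m (0 : R) 0; rewrite subr0 eqxx.
have Xn_neq0 m : 'X^m != 0 :> {poly R} by rewrite expf_neq0 ?polyX_eq0.
(* Multiplicities of 0: \rank A plus that for [A] on the left, n + 0 on the right. *)
have := congr1 (mup 0) (char_poly_mulmxC C D).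
rewrite mulmx_base mupM ?Xn_neq0 ?monic_neq0 ?char_poly_monic //.
by rewrite mupMl // !mupXn => /(congr1 (subn^~ (\rank A))); rewrite addKn.
Qed.

(** * Signed adjacency matrices and leaf matchings *)

Lemma nullityE (R : rcfType) (S : signed_graph) :
  nullity R S = (#|underlying S| - \rank (signed_adj_mx R S))%N.
Proof.
rewrite /nullity mup0_char_poly_sym //.
by apply/matrixP => i j; rewrite !mxE /= adj_sym setUC.
Qed.

Lemma signed_adj_mxE (R : rcfType) (S : signed_graph) (x y : underlying S) :
  signed_adj_mx R S (enum_rank x) (enum_rank y) =
  if adj x y then (-1) ^+ sign [set x; y] else 0.
Proof. by rewrite mxE /= !enum_rankK. Qed.

(* The edges l_i k_i form a matching of size three from which one may strip
   leaves: l1 is pendant at k1, and once both are removed, l2 is pendant at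
   k2. *)
Definition leaf_matching (G : sgraph) (l1 k1 l2 k2 l3 k3 : G) : bool :=
  [&& adj l1 k1, adj l2 k2, adj l3 k3,
      [&& ~~ adj l1 l2, ~~ adj l1 k2, ~~ adj l1 l3 & ~~ adj l1 k3],
      ~~ adj l2 l3 & ~~ adj l2 k3].

Lemma leaf_matching_rank (R : rcfType) (S : signed_graph)
    (l1 k1 l2 k2 l3 k3 : underlying S) :
  leaf_matching l1 k1 l2 k2 l3 k3 -> (6 <= \rank (signed_adj_mx R S))%N.
Proof.
case/and5P => e1 e2 e3 /and4P[n12 n12' n13 n13'] /andP[n23 n23'].
(* Leaves come in stripping order, then the neighbours in reverse; columns list the partners. The
   matching fills the diagonal, and only non-edges lie above it. *)
pose f (i : 'I_6) := nth l1 [:: l1; l2; l3; k3; k2; k1] i.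
pose g (i : 'I_6) := nth l1 [:: k1; k2; k3; l3; l2; l1] i.
apply: (@leq_mxrank_trig _ _ _ _ (enum_rank \o f) (enum_rank \o g)) => [i|i j].
  rewrite signed_adj_mxE.
  suff -> : adj (f i) (g i) by rewrite signr_eq0.
  by case: i => [[|[|[|[|[|[|[]]]]]]] ?] //; rewrite /f /g /= // adj_sym.
rewrite signed_adj_mxE => lt_ij; rewrite ifN //.
case: i j lt_ij => i lt_i [j lt_j]; rewrite /f /g /= => lt_ij.
case: j lt_j lt_ij => [|[|[|[|[|[|//]]]]]] _;
  case: i lt_i => [|[|[|[|[|[|//]]]]]] _ // _; rewrite /= ?adj_irr //;
  by rewrite adj_sym.
Qed.

(** * Labelled cycles and two cycles sharing a vertex *)

(* The vertices of C_p are listed cyclically from a 0; values of a at indices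
   p and beyond are irrelevant. *)
Definition cycle_labelling (G : sgraph) (p : nat) (a : nat -> G) : Prop :=
  forall i j, (i < p)%N -> (j < p)%N ->
    adj (a i) (a j) =
      [|| j == i.+1, i == j.+1, (i == 0%N) && (j == p.-1)
        | (j == 0%N) && (i == p.-1)].

Lemma cycle_graph_labelling (p : nat) (u : cycle_graph p) :
    (3 <= p)%N ->
  exists a : nat -> cycle_graph p,
    [/\ cycle_labelling p a, a 0%N = u, {in gtn p &, injective a}
      & forall x, exists2 i, (i < p)%N & a i = x].
Proof.
move=> p_ge3; have p_gt0 : (0 < p)%N by apply: leq_trans p_ge3.
pose a i : cycle_graph p := iter i (@ordS p) u.
have a_val i : val (a i) = ((u + i) %% p)%N.
  elim: i => [|i IHi]; first by rewrite addn0 modn_small ?(ltn_ord u).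
  rewrite /= -[nat_of_ord (iter _ _ _)]/(val (a i)) IHi.
  by rewrite -addn1 modnDml addn1 addnS.
have eq_a i j : (a i == a j) = (i == j %[mod p]).
  by rewrite -val_eqE !a_val eqn_modDl.
have succ_mod i : (i < p)%N -> (i.+1 %% p = if i == p.-1 then 0 else i.+1)%N.
  move=> lt_ip; case: eqVneq => [->|ne_i]; first by rewrite prednK ?modnn.
  by rewrite modn_small // -(prednK p_gt0) ltnS ltn_neqAle ne_i -ltnS prednK.
exists a; split => // [i j lt_ip lt_jp|i j lt_ip lt_jp|x].
- rewrite /= /cycle_adj -2![ordS (a _)]/(a _.+1) !eq_a !succ_mod //.
  by rewrite !modn_small //; repeat case: eqP => /=; lia.
- by move=> /eqP; rewrite eq_a !modn_small // => /eqP.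
(* The index is x - u modulo p, written without truncated subtraction. *)
exists ((x + (p - u)) %% p)%N; first by rewrite ltn_mod.
apply/val_inj; rewrite a_val modnDmr addnCA subnKC; last exact/ltnW/ltn_ord.
by rewrite modnDr modn_small ?ltn_ord.
Qed.

Section TwoCycles.
Variables (G : sgraph) (p q : nat) (a b : nat -> G).
Hypotheses (p_ge3 : (3 <= p)%N) (q_ge3 : (3 <= q)%N).
Hypotheses (a_cycle : cycle_labelling p a) (b_cycle : cycle_labelling q b).
Hypothesis ab0 : a 0%N = b 0%N.
Hypothesis abN : forall i j, (0 < i < p)%N -> (0 < j < q)%N ->
  ~~ adj (a i) (b j).

Lemma leaf_matching_long_cycle :
  (5 <= q)%N -> leaf_matching (b 1%N) (b 2%N) (b 3) (b 4) (a 1%N) (a 2%N).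
Proof.
move=> q_ge5; rewrite /leaf_matching !b_cycle ?a_cycle; try lia.
by rewrite ![adj (b _) (a _)]adj_sym !abN //=; lia.
Qed.

(** Stripping [t] with [a i] opens the first cycle into a path, from which the next leaf is
    taken. *)
Lemma leaf_matching_pendant (t : G) (i : nat) :
    (p <= 4)%N -> (i < p)%N ->
    (forall j, (j < p)%N -> adj t (a j) = (j == i)) ->
    (forall j, (0 < j < q)%N -> ~~ adj t (b j)) ->
  exists l1 k1 l2 k2 l3 k3 : G, leaf_matching l1 k1 l2 k2 l3 k3.
Proof.
move=> p_le4 lt_ip t_a t_b.
have a0b j : (0 < j < q)%N -> adj (a 0%N) (b j) = (j == 1%N) || (j == q.-1).
  by move=> /andP[j_gt0 lt_jq]; rewrite ab0 b_cycle; lia.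
(* At the shared vertex, the deletion separates the cycles, leaving one edge from each. *)
have [i0|i_gt0] := posnP i.
  exists t, (a 0%N), (a 1%N), (a 2%N), (b 1%N), (b 2%N).
  rewrite /leaf_matching i0 in t_a *.
  rewrite !t_a ?a_cycle ?b_cycle ?t_b ?abN //; lia.
(* In a triangle, the third vertex [a (3 - i)] becomes pendant at [a 0]. *)
have [p3|p4] : p = 3 \/ p = 4 by lia.
  exists t, (a i), (a (3 - i)%N), (a 0%N), (b 1%N), (b 2%N).
  by rewrite /leaf_matching !t_a ?a_cycle ?b_cycle ?t_b ?abN ?a0b //; lia.
(* Opposite the shared vertex of a 4-cycle: [a 1] becomes pendant at [a 0]. *)
have [i2|i_neq2] := eqVneq i 2.
  exists t, (a 2%N), (a 1%N), (a 0%N), (b 1%N), (b 2%N).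
  rewrite /leaf_matching i2 in t_a *.
  by rewrite !t_a ?a_cycle ?b_cycle ?t_b ?abN ?a0b //; lia.
(* Here i is 1 or 3: [a 2] becomes pendant at [a (4 - i)], and the shared vertex keeps its edge to
   [b 1]. *)
exists t, (a i), (a 2%N), (a (4 - i)%N), (a 0%N), (b 1%N).
by rewrite /leaf_matching !t_a ?a_cycle ?b_cycle ?t_b ?abN ?a0b //; lia.
Qed.
End TwoCycles.

(** * The second cycle inside a coalescence *)

Section CoalescenceEmbedding.
Variables (G H : sgraph) (u : G) (v : H).

(** The vertex [v], absent from the right copy, goes to the merged vertex. *)
Definition coalescence_inr (y : H) : coalescence u v :=
  if insub y is Some y' then inr y' else inl u.

Lemma coalescence_inr_base : coalescence_inr v = inl u.
Proof. by rewrite /coalescence_inr insubN ?eqxx. Qed.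

Lemma coalescence_inr_val (y : {y : H | y != v}) :
  coalescence_inr (val y) = inr y.
Proof. by rewrite /coalescence_inr valK. Qed.

Lemma eq_or_val_neq (y : H) :
  y = v \/ exists y' : {y : H | y != v}, y = val y'.
Proof.
by have [->|y_neqv] := eqVneq y v; [left | right; exists (Sub y y_neqv)].
Qed.

Lemma coalescence_inr_inj : injective coalescence_inr.
Proof.
move=> y z; have [->|[y' ->]] := eq_or_val_neq y;
  have [->|[z' ->]] := eq_or_val_neq z;
  by rewrite ?coalescence_inr_base ?coalescence_inr_val // => -[->].
Qed.

Lemma adj_coalescence_inr (y z : H) :
  adj (coalescence_inr y) (coalescence_inr z) = adj y z.
Proof.
have [->|[y' ->]] := eq_or_val_neq y;
  have [->|[z' ->]] := eq_or_val_neq z;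
  rewrite ?coalescence_inr_base ?coalescence_inr_val /= ?adj_irr ?eqxx //.
by rewrite adj_sym.
Qed.

Lemma coalescence_inr_neq (x : G) (y : H) :
  y != v -> coalescence_inr y != inl x.
Proof.
by have [->|[y' ->]] := eq_or_val_neq y; rewrite ?eqxx ?coalescence_inr_val.
Qed.

Lemma adj_coalescence_inl_inr (x : G) (y : H) :
  x != u -> y != v -> ~~ adj (inl x : coalescence u v) (coalescence_inr y).
Proof.
have [->|[y' ->]] := eq_or_val_neq y; rewrite ?eqxx // coalescence_inr_val.
by move=> /negPf /= ->.
Qed.

Lemma card_coalescence : #|coalescence u v| = (#|G| + #|H|.-1)%N.
Proof. by rewrite card_sum card_sig cardC1. Qed.
End CoalescenceEmbedding.

(** * Leaf matchings in graphs of B_n^{++} *)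

(** Take [t] as the first step of a path from [f c] to [x] inside the tree at c = r x. An edge from
    [t] to another [f d] would leave this tree and force [t] = [f c]. *)
Lemma attaches_trees_pendant (H G : sgraph) (f : H -> G) (r : G -> H) (x : G) :
    cancel f r ->
    (forall y z : G, adj y z -> r y = r z \/ (y = f (r y) /\ z = f (r z))) ->
    (forall b : H, is_tree (induced [pred y : G | r y == b])) ->
    f (r x) != x ->
  exists (t : G) (c : H), forall d, adj t (f d) = (d == c).
Proof.
move=> fK adj_r trees x_neq; set c := r x.
have [conn _] := trees c.
have fc_in : [pred y : G | r y == c] (f c) by rewrite /= fK.
have x_in : [pred y : G | r y == c] x by rewrite /=.
have /connectP[[|t s] /= path_s last_s] :=
  conn (Sub (f c) fc_in : induced _) (Sub x x_in).
  by case/eqP: x_neq; have [] := last_s.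
have {path_s s last_s} /andP[adj_t _] := path_s.
have t_c : r (val t) = c by apply/eqP; exact: (valP t).
have adj_ft : adj (f c) (val t) by [].
exists (val t), c => d; apply/idP/eqP => [adj_td|->]; last by rewrite adj_sym.
have [|[t_f _]] := adj_r _ _ adj_td; first by rewrite fK t_c.
by move: adj_ft; rewrite t_f t_c adj_irr.
Qed.

Lemma Bpp_leaf_matching (n : nat) (G : sgraph) :
    (8 <= n)%N -> Bpp n G ->
  exists l1 k1 l2 k2 l3 k3 : G, leaf_matching l1 k1 l2 k2 l3 k3.
Proof.
move=> n_ge8 [cardG _ [p [q [u [v [p_ge3 q_ge3]]]]]].
move=> [f [r [fK f_adj adj_r trees]]].
have [a0 [a0_cycle a0u a0_inj a0_surj]] := cycle_graph_labelling u p_ge3.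
have [b0 [b0_cycle b0v b0_inj b0_surj]] := cycle_graph_labelling v q_ge3.
pose e := @coalescence_inr _ _ u v.
pose a i := f (inl (a0 i)); pose b j := f (e (b0 j)).
have a_cycle : cycle_labelling p a.
  by move=> i j lt_ip lt_jp; rewrite /a f_adj; exact: a0_cycle.
have b_cycle : cycle_labelling q b.
  move=> i j lt_ip lt_jp; rewrite /b f_adj adj_coalescence_inr.
  exact: b0_cycle.
have ab0 : a 0%N = b 0%N by rewrite /a /b a0u b0v /e coalescence_inr_base.
have a0_neq i : (0 < i < p)%N -> a0 i != u.
  move=> /andP[i_gt0 lt_ip]; rewrite -a0u (inj_in_eq a0_inj) ?inE; lia.
have b0_neq j : (0 < j < q)%N -> b0 j != v.
  move=> /andP[j_gt0 lt_jq]; rewrite -b0v (inj_in_eq b0_inj) ?inE; lia.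
have abN i j : (0 < i < p)%N -> (0 < j < q)%N -> ~~ adj (a i) (b j).
  move=> lt_ip lt_jq; rewrite f_adj.
  by apply: adj_coalescence_inl_inr; [apply: a0_neq | apply: b0_neq].
have baN j i : (0 < j < q)%N -> (0 < i < p)%N -> ~~ adj (b j) (a i).
  by move=> lt_jq lt_ip; rewrite adj_sym abN.
have [q_ge5|q_lt5] := leqP 5 q.
  do 6!eexists.
  exact: leaf_matching_long_cycle p_ge3 q_ge3 a_cycle b_cycle abN q_ge5.
have [p_ge5|p_lt5] := leqP 5 p.
  do 6!eexists.
  exact: leaf_matching_long_cycle q_ge3 p_ge3 b_cycle a_cycle baN p_ge5.
(* Otherwise [r] is injective and n <= p + q - 1 <= 7. *)
have [x x_neq] : exists x, f (r x) != x.
  apply/existsP; apply: contraLR n_ge8; rewrite negb_exists => /forallP frK.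
  have rK : cancel r f by move=> x; apply/eqP; have := frK x; rewrite negbK.
  have := leq_card r (can_inj rK).
  by rewrite cardG card_coalescence !card_ord; lia.
have [t [c t_f]] := attaches_trees_pendant fK adj_r trees x_neq.
(* The shared vertex is counted with the first cycle, so j > 0; the cases then differ by swapping
   the cycles. *)
have [[i lt_ip c_i]|[j lt_jq c_j]] : (exists2 i, (i < p)%N & c = inl (a0 i)) \/
    (exists2 j, (0 < j < q)%N & c = e (b0 j)).
- case: c {t_f} => [y|y].
    by left; have [i lt_ip <-] := a0_surj y; exists i.
  right; have [j lt_jq b0j] := b0_surj (val y).
  exists j; last by rewrite b0j /e coalescence_inr_val.
  rewrite lt_jq andbT lt0n; apply: contraNneq (valP y) => j0.
  by rewrite -b0j j0 b0v.
- apply: (leaf_matching_pendant p_ge3 q_ge3 a_cycle b_cycle ab0 abN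
    (t := t) (i := i)) => // [k lt_kp|k lt_kq].
    by rewrite t_f c_i -(inj_in_eq a0_inj).
  by rewrite t_f c_i coalescence_inr_neq ?b0_neq.
apply: (leaf_matching_pendant q_ge3 p_ge3 b_cycle a_cycle (esym ab0) baN
  (t := t) (i := j)) => // [|k lt_kq|k lt_kp].
- by case/andP: lt_jq.
- rewrite t_f c_j (inj_eq (@coalescence_inr_inj _ _ _ _)) (inj_in_eq b0_inj) //.
  by case/andP: lt_jq.
by rewrite t_f c_j eq_sym coalescence_inr_neq ?b0_neq.
Qed.

Theorem theorem5p5 (R : rcfType) (n : nat) (S : signed_graph)
  (hn : (8 <= n)%N) (hG : Bpp n (underlying S)) :
  (nullity R S <= n - 6)%N.
Proof.
have [l1 [k1 [l2 [k2 [l3 [k3 matching]]]]]] := Bpp_leaf_matching hn hG.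
have [cardG _ _] := hG.
by rewrite nullityE -cardG leq_sub2l // (leaf_matching_rank R matching).
Qed.
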